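(* Let $(\mathfrak{g},[\cdot,\cdot],\alpha)$ be a multiplicative Hom-Lie superalgebra with surjective twisting map $\alpha$. For every $n\ge 2$, let $\mathfrak{g}_n=(\mathfrak{g},[\cdot,\ldots,\cdot]_n,\beta_n)$, $\beta_n=\alpha^{n-1}$, be the recursively induced multiplicative $n$-ary Hom-Nambu superalgebra, where $[x_1,x_2]_2=[x_1,x_2]$ and $$[x_1,\ldots,x_n]_n=\bigl[[x_1,\ldots,x_{n-1}]_{n-1},\alpha^{n-2}(x_n)\bigr]\quad\text{for } n\ge 3.$$ For $1\le i\le n$ let $C_i(\mathfrak{g}_n)=\{x\in\mathfrak{g}: [y_1,\ldots,y_{i-1},x,y_{i+1},\ldots,y_n]_n=0\ \text{for all } y_j\in\mathfrak{g}\}$, and set $C(\mathfrak{g}_n)=\bigcap_{i=1}^nC_i(\mathfrak{g}_n)$. Then $$C(\mathfrak{g})=\{0\}\iff C(\mathfrak{g}_n)=\{0\}.$$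
   Context: Vector spaces are over a field $\mathbb{K}$ of characteristic zero. A multiplicative Hom-Lie superalgebra $(\mathfrak{g},[\cdot,\cdot],\alpha)$ is a $\mathbb{Z}_2$-graded space $\mathfrak{g}=\mathfrak{g}_{\bar0}\oplus\mathfrak{g}_{\bar1}$ with an even bilinear bracket ($[\mathfrak{g}_{\bar i},\mathfrak{g}_{\bar j}]\subseteq\mathfrak{g}_{\bar i+\bar j}$) and an even (grading-preserving) linear map $\alpha$ such that $\alpha([x,y])=[\alpha(x),\alpha(y)]$ for all $x,y$ and, for homogeneous $x,y,z$ of parities $|x|,|y|,|z|$: $[x,y]=-(-1)^{|x||y|}[y,x]$ and $\sum_{\circlearrowleft_{x,y,z}}(-1)^{|x||z|}[\alpha(x),[y,z]]=0$ (sum over cyclic permutations of $x,y,z$). Its center is $C(\mathfrak{g})=\{x\in\mathfrak{g}:[x,\mathfrak{g}]=0\}$. It is a known result that the triple $\mathfrak{g}_n$ is a multiplicative $n$-ary Hom-Nambu superalgebra, i.e. $[\cdot,\ldots,\cdot]_n$ is an even $n$-linear bracket, $\beta_n$ is even and preserves it, and the super-Hom-Nambu identity $[\beta_n(x_1),\ldots,\beta_n(x_{n-1}),[y_1,\ldots,y_n]_n]_n=\sum_{i=1}^n(-1)^{(|x_1|+\cdots+|x_{n-1}|)(|y_1|+\cdots+|y_{i-1}|)}[\beta_n(y_1),\ldots,\beta_n(y_{i-1}),[x_1,\ldots,x_{n-1},y_i]_n,\beta_n(y_{i+1}),\ldots,\beta_n(y_n)]_n$ holds for homogeneous elements. *)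

(* Defs.v *)
From HB Require Import structures.
From mathcomp Require Import all_boot all_order all_algebra.
From mathcomp Require Import classical_sets.

Set Implicit Arguments.
Unset Strict Implicit.
Unset Printing Implicit Defensive.

Import GRing.Theory.
Local Open Scope ring_scope.

(* Parities in Z/2 are booleans: addition is addb (written (+)) and the product
   |x||y| is &&, so that (-1) ^+ (p && q) is the Koszul sign. *)
Record superspace (K : fieldType) := Superspace {
  super_sort :> lmodType K;
  gr : bool -> {pred super_sort};
  gr_submod : forall p, submod_closed (gr p);
  gr_sum : forall x, exists x0 x1,
    [/\ x0 \in gr false, x1 \in gr true & x = x0 + x1];
  gr_cap : forall x, x \in gr false -> x \in gr true -> x = 0
}.

Arguments gr {K V} : rename.

Definition even_map (K : fieldType) (V : superspace K) (f : V -> V) :=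
  forall p x, x \in gr p -> f x \in gr p.

Record homLieSuperalgebra (K : fieldType) := HomLieSuperalgebra {
  hl_space :> superspace K;
  br : {bilinear hl_space -> hl_space -> hl_space};
  alpha : {linear hl_space -> hl_space};
  br_even : forall p q x y,
    x \in gr p -> y \in gr q -> br x y \in gr (p (+) q);
  alpha_even : even_map alpha;
  alpha_br : forall x y, alpha (br x y) = br (alpha x) (alpha y);
  br_skew : forall p q x y, x \in gr p -> y \in gr q ->
    br x y = - ((-1) ^+ (p && q) *: br y x);
  br_jacobi : forall p q r x y z, x \in gr p -> y \in gr q -> z \in gr r ->
    (-1) ^+ (p && r) *: br (alpha x) (br y z)
    + (-1) ^+ (q && p) *: br (alpha y) (br z x)
    + (-1) ^+ (r && q) *: br (alpha z) (br x y) = 0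
}.

Arguments br {K g} : rename.
Arguments alpha {K g} : rename.

Definition center (K : fieldType) (g : homLieSuperalgebra K) : set g :=
  [set x | forall y, br x y = 0]%classic.

Definition upd (n : nat) (T : Type) (y : {ffun 'I_n -> T}) (i : 'I_n) (x : T) :
  {ffun 'I_n -> T} := [ffun j => if j == i then x else y j].

(* In nambu_identity, l is the last index and the n - 1 arguments
   x_1, ..., x_(n-1) are the x j with j != l; the value x l is never used. *)
Record homNambuSuperalgebra (K : fieldType) (n : nat) := HomNambuSuperalgebra {
  hn_space :> superspace K;
  nbr : {ffun 'I_n -> hn_space} -> hn_space;
  nbeta : {linear hn_space -> hn_space};
  nbr_linear : forall (y : {ffun 'I_n -> hn_space}) i,
    linear (fun x : hn_space => nbr (upd y i x));
  nbr_even : forall (p : 'I_n -> bool) (x : {ffun 'I_n -> hn_space}),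
    (forall j, x j \in gr (p j)) -> nbr x \in gr (\big[addb/false]_j p j);
  nbeta_even : even_map nbeta;
  nbeta_nbr : forall x : {ffun 'I_n -> hn_space},
    nbeta (nbr x) = nbr [ffun j => nbeta (x j)];
  nambu_identity : forall (l : 'I_n) (p q : 'I_n -> bool)
      (x y : {ffun 'I_n -> hn_space}),
    l.+1 = n ->
    (forall j, j != l -> x j \in gr (p j)) -> (forall j, y j \in gr (q j)) ->
    nbr (upd [ffun j => nbeta (x j)] l (nbr y)) =
    \sum_(i < n)
      (-1) ^+ ((\big[addb/false]_(j < n | j != l) p j)
               && (\big[addb/false]_(j < n | (j < i)%N) q j))
      *: nbr (upd [ffun j => nbeta (y j)] i (nbr (upd x l (y i))))
}.

Arguments nbr {K n G} : rename.
Arguments nbeta {K n G} : rename.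

Definition ncenter_at (K : fieldType) (n : nat) (G : homNambuSuperalgebra K n)
  (i : 'I_n) : set G :=
  [set x | forall y : {ffun 'I_n -> G}, nbr (upd y i x) = 0]%classic.

Definition ncenter (K : fieldType) (n : nat) (G : homNambuSuperalgebra K n) :
  set G := (\bigcap_(i in [set: 'I_n]) @ncenter_at K n G i)%classic.

Arguments center {K} g.
Arguments ncenter_at {K n} G i.
Arguments ncenter {K n} G.

Section Induced.
Variables (K : fieldType) (g : homLieSuperalgebra K).

Definition alpha_pow (k : nat) (x : g) : g := iter k alpha x.

Lemma alpha_pow_is_linear k : linear (alpha_pow k).
Proof.
elim: k => [|k IH] a x y //.
by rewrite [LHS](congr1 alpha (IH a x y)) linearP.
Qed.

HB.instance Definition _ k :=
  GRing.isLinear.Build K g g _ (alpha_pow k) (alpha_pow_is_linear k).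

Definition front (T : Type) (n : nat) (x : {ffun 'I_n.+1 -> T}) :
  {ffun 'I_n -> T} := [ffun i => x (widen_ord (leqnSn n) i)].

(* With the convention [x]_1 = x the recursion formula
   [x_1, ..., x_n]_n = [[x_1, ..., x_(n-1)]_(n-1), alpha^(n-2) x_n]
   also covers n = 2; the value at n = 0 is irrelevant. *)
Fixpoint induced_br (n : nat) : {ffun 'I_n -> g} -> g :=
  match n return {ffun 'I_n -> g} -> g with
  | 0 => fun=> 0
  | m.+1 =>
    match m return ({ffun 'I_m -> g} -> g) -> {ffun 'I_m.+1 -> g} -> g with
    | 0 => fun _ x => x ord0
    | k.+1 => fun brm x => br (brm (front x)) (alpha_pow k (x ord_max))
    end (@induced_br m)
  end.

Lemma induced_br2 (x : {ffun 'I_2 -> g}) :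
  induced_br x = br (x ord0) (x ord_max).
Proof. by rewrite /= ffunE; congr (br (x _) _); apply: val_inj. Qed.

Lemma induced_brS n (x : {ffun 'I_n.+3 -> g}) :
  induced_br x = br (induced_br (front x)) (alpha_pow n.+1 (x ord_max)).
Proof. by []. Qed.

Let brS n (x : {ffun 'I_n.+2 -> g}) :
  induced_br x = br (induced_br (front x)) (alpha_pow n (x ord_max)).
Proof. by []. Qed.

Let widen_neq_max n (i : 'I_n) : (ord_max == widen_ord (leqnSn n) i) = false.
Proof. by apply/eqP => /(congr1 val) /= e; have := ltn_ord i; rewrite -e ltnn. Qed.

Let widen_eq n (i j : 'I_n) :
  (widen_ord (leqnSn n) i == widen_ord (leqnSn n) j) = (i == j).
Proof. by []. Qed.

Let front_upd_max (T : Type) n (x : {ffun 'I_n.+1 -> T}) z :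
  front (upd x ord_max z) = front x.
Proof. by apply/ffunP => i; rewrite !ffunE eq_sym widen_neq_max. Qed.

Let front_upd (T : Type) n (x : {ffun 'I_n.+1 -> T}) i z :
  front (upd x (widen_ord (leqnSn n) i) z) = upd (front x) i z.
Proof. by apply/ffunP => j; rewrite !ffunE widen_eq. Qed.

Let front_map (T : Type) n (f : T -> T) (x : {ffun 'I_n.+1 -> T}) :
  front [ffun j => f (x j)] = [ffun j => f (front x j)].
Proof. by apply/ffunP => j; rewrite !ffunE. Qed.

Let ordP n (i : 'I_n.+1) : i = ord_max \/ exists j, i = widen_ord (leqnSn n) j.
Proof.
have [e|lt] := eqVneq (val i) n; first by left; apply: val_inj.
have ltn : (i < n)%N by rewrite ltn_neqAle lt -ltnS ltn_ord.
by right; exists (Ordinal ltn); apply: val_inj.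
Qed.

Let brDl (x x' y : g) a : br (a *: x + x') y = a *: br x y + br x' y.
Proof. exact: linearPl. Qed.

Lemma induced_br_linear n (y : {ffun 'I_n -> g}) i :
  linear (fun x : g => induced_br (upd y i x)).
Proof.
case: n y i => [|n] y i; first by case: i.
elim: n y i => [|n IH] y i a u v; first by rewrite /= !ffunE [ord0]ord1 (ord1 i).
rewrite !brS; case: (ordP i) => [->|[j ->]].
  by rewrite !front_upd_max !ffunE eqxx !linearP.
by rewrite !front_upd !ffunE widen_neq_max IH brDl.
Qed.

Lemma alpha_pow_even k : even_map (alpha_pow k).
Proof. by elim: k => [|k IH] p x xp //=; apply/alpha_even/IH. Qed.

Lemma alpha_pow_br k (x y : g) :
  alpha_pow k (br x y) = br (alpha_pow k x) (alpha_pow k y).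
Proof. by elim: k => // k IH; rewrite /alpha_pow /= -/(alpha_pow k _) IH alpha_br. Qed.

Lemma induced_br_even n (p : 'I_n -> bool) (x : {ffun 'I_n -> g}) :
  (forall j, x j \in gr (p j)) -> induced_br x \in gr (\big[addb/false]_j p j).
Proof.
case: n p x => [|n] p x; first by rewrite big_ord0 => _; case: (gr_submod g false).
elim: n p x => [|n IH] p x xp; first by rewrite big_ord1; apply: xp.
rewrite brS big_ord_recr; apply: br_even; last exact/alpha_pow_even/xp.
by apply: IH => j; rewrite ffunE; apply: xp.
Qed.

Lemma alpha_pow_induced_br k n (x : {ffun 'I_n -> g}) :
  alpha_pow k (induced_br x) = induced_br [ffun j => alpha_pow k (x j)].
Proof.
case: n x => [|n] x; first by rewrite /= linear0.
elim: n x => [|n IH] x; first by rewrite /= ffunE.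
rewrite !brS alpha_pow_br IH front_map ffunE /alpha_pow -!iterD.
by rewrite addnC.
Qed.

Lemma br_leibniz p q r (x y z : g) : x \in gr p -> y \in gr q -> z \in gr r ->
  br (alpha x) (br y z) =
  br (br x y) (alpha z) + (-1) ^+ (p && q) *: br (alpha y) (br x z).
Proof.
move=> xp yq zr; have := br_jacobi xp yq zr.
rewrite (br_skew (br_even xp yq) (alpha_even zr)) (br_skew zr xp) linearNr linearZr_LR.
move: (br (alpha x) _) (br (alpha y) _) (br (alpha z) _) => A B C.
by case: p xp; case: q yq; case: r zr => /= _ _ _;
  rewrite ?expr0 ?expr1 ?scaleN1r ?scale1r ?opprK => h;
  apply/eqP; rewrite -subr_eq0; apply/eqP;
  first [apply: etrans h; rewrite ?opprD ?opprK ?addrA; by [|rewrite addrAC]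
  | apply: oppr_inj; rewrite oppr0; apply: etrans h;
    rewrite ?opprD ?opprK ?addrA; by [|rewrite addrAC]].
Qed.

Lemma induced_br_leibniz n p (q : 'I_n.+1 -> bool) (x : g) (y : {ffun 'I_n.+1 -> g}) :
  x \in gr p -> (forall j, y j \in gr (q j)) ->
  br (alpha_pow n x) (induced_br y) =
  \sum_(i < n.+1) (-1) ^+ (p && \big[addb/false]_(j < n.+1 | (j < i)%N) q j)
    *: induced_br (upd [ffun j => alpha (y j)] i (br x (y i))).
Proof.
move=> xp; elim: n q y => [|n IH] q y yq.
  rewrite big_ord1 big_pred0 ?andbF ?scale1r; last by move=> j; rewrite [j]ord1.
  by rewrite /= ffunE.
have fq j : front y j \in gr (q (widen_ord (leqnSn n.+1) j)).
  by rewrite ffunE; apply: yq.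
rewrite brS.
rewrite [LHS](br_leibniz (@alpha_pow_even n _ _ xp) (induced_br_even fq)
              (@alpha_pow_even n _ _ (yq ord_max))).
rewrite (IH _ _ fq) [RHS]big_ord_recr; congr (_ + _).
  rewrite linear_sumlz; apply: eq_bigr => i _.
  rewrite linearZl_LR [in RHS]brS front_upd front_map !ffunE widen_neq_max.
  congr (_ *: _).
    congr (_ ^+ (_ && _)); rewrite [RHS]big_mkcond [RHS]big_ord_recr /=.
    by rewrite [X in _ (+) X]ifF ?addbF -?big_mkcond // ltnNge ltnW.
  by congr (br _ _); rewrite /alpha_pow -iterS iterSr.
congr (_ *: _).
  congr (_ ^+ (_ && _)); rewrite [RHS]big_mkcond [RHS]big_ord_recr /= ltnn addbF.
  by apply: eq_bigr => i _; rewrite ltn_ord.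
rewrite [in RHS]brS front_upd_max front_map ffunE eqxx -alpha_pow_br; congr (br _ _).
by rewrite -[alpha _]/(alpha_pow 1 _) alpha_pow_induced_br.
Qed.

Lemma induced_nambu n (l : 'I_n) (p q : 'I_n -> bool) (x y : {ffun 'I_n -> g}) :
  l.+1 = n ->
  (forall j, j != l -> x j \in gr (p j)) -> (forall j, y j \in gr (q j)) ->
  induced_br (upd [ffun j => alpha_pow n.-1 (x j)] l (induced_br y)) =
  \sum_(i < n)
    (-1) ^+ ((\big[addb/false]_(j < n | j != l) p j)
             && (\big[addb/false]_(j < n | (j < i)%N) q j))
    *: induced_br (upd [ffun j => alpha_pow n.-1 (y j)] i
                       (induced_br (upd x l (y i)))).
Proof.
case: n l p q x y => [[]//|[|n]] l p q x y ln xp yq.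
  rewrite big_ord1 [X in X && _]big_pred0 ?scale1r; last by move=> j; rewrite !ord1.
  by rewrite /= !ffunE !ord1.
have {ln} el : l = ord_max by apply: val_inj; case: ln.
rewrite {l}el in xp *.
have {}xp j : front x j \in gr (p (widen_ord (leqnSn n.+1) j)).
  by rewrite ffunE; apply: xp; rewrite eq_sym widen_neq_max.
rewrite brS front_upd_max front_map ffunE eqxx -alpha_pow_induced_br.
rewrite (alpha_pow_induced_br n).
have yq' j : [ffun j => alpha_pow n (y j)] j \in gr (q j).
  by rewrite ffunE; apply/alpha_pow_even/yq.
rewrite (induced_br_leibniz (induced_br_even xp) yq'); apply: eq_bigr => i _.
congr (_ *: _).
  congr (_ ^+ (_ && _)); rewrite [RHS]big_mkcond [RHS]big_ord_recr /= eqxx addbF.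
  by apply: eq_bigr => j _; rewrite eq_sym widen_neq_max.
congr (induced_br (upd _ _ _)); first by apply/ffunP => j; rewrite !ffunE.
by rewrite brS front_upd_max !ffunE eqxx.
Qed.

Definition induced (n : nat) : homNambuSuperalgebra K n :=
  @HomNambuSuperalgebra K n g (@induced_br n) (alpha_pow n.-1)
    (@induced_br_linear n) (@induced_br_even n) (@alpha_pow_even n.-1)
    (@alpha_pow_induced_br n.-1 n) (@induced_nambu n).

End Induced.

(* Main.v *)
Require Import Defs.
From mathcomp Require Import all_boot all_order all_algebra.
From mathcomp Require Import classical_sets.

Import GRing.Theory.
Local Open Scope ring_scope.
Local Open Scope classical_set_scope.

(** Unfolding the recursion,
      [x_1, ..., x_n]_n = [...[[x_1, x_2], alpha x_3], ..., alpha^(n-2) x_n].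

    If the center of g is trivial, then so is already C_1(g_n): when such a
    nested bracket vanishes for all x_2, ..., x_n, surjectivity of alpha lets
    alpha^(n-2) x_n run over all of g, so the inner bracket
    [x_1, ..., x_(n-1)]_(n-1) is central, hence zero. Peeling off one argument
    at a time leaves x_1 = 0 ([induced_br_nondegenerate]).

    Conversely a central x kills every nested bracket in which it occurs
    ([induced_br_center]). In first position this is immediate. In position
    i > 1 it occurs as [u, alpha^(i-2) x], which vanishes because alpha, being
    surjective, maps the center into itself ([alpha_pow_center]), and because
    elements that annihilate g from the left also annihilate it from the right
    ([br_center_r]). Thus C(g) is contained in C(g_n). *)

Section CenterOfInduced.

Set Implicit Arguments.
Unset Strict Implicit.

Lemma gr_add_eq0 (K : fieldType) (V : superspace K) p (a b : V) :
  a \in gr p -> b \in gr (~~ p) -> a + b = 0 -> a = 0 /\ b = 0.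
Proof.
move=> ap bp ab0.
have [zero_p lin_p] := gr_submod V p.
have eb : b = -1 *: a + 0.
  by rewrite addr0 scaleN1r; apply/eqP; rewrite -addr_eq0 addrC ab0.
have bp' : b \in gr p by rewrite eb; apply: lin_p.
have b0 : b = 0 by case: p {ap zero_p lin_p} bp bp' => bp bp'; apply: gr_cap.
by move: ab0; rewrite b0 addr0.
Qed.

Variables (K : fieldType) (g : homLieSuperalgebra K).

(** Super skew-symmetry relates [x, y] and [y, x] for homogeneous elements
    only, so the center has to be seen to be graded: for homogeneous y the
    brackets of y with the two components of a central x have different
    parities and sum to zero, hence vanish separately. *)
Lemma br_center_r (x y : g) : center g x -> br y x = 0.
Proof.
have [x0 [x1 [x0P x1P ->]]] := gr_sum x => xC.
have [y0 [y1 [y0P y1P ->]]] := gr_sum y.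
have homog q z : z \in gr q -> br z (x0 + x1) = 0.
  move=> zq; have e : br x0 z + br x1 z = 0 by rewrite -linearDl xC.
  have [e0 e1] := gr_add_eq0 (br_even x0P zq) (br_even x1P zq) e.
  by rewrite linearDr (br_skew zq x0P) (br_skew zq x1P) e0 e1 !scaler0 oppr0 addr0.
by rewrite linearDl (homog _ _ y0P) (homog _ _ y1P) addr0.
Qed.

Hypothesis alpha_surj : forall y : g, exists x : g, alpha x = y.

Lemma alpha_pow_surj k (y : g) : exists x : g, alpha_pow k x = y.
Proof.
elim: k y => [|k IH] y; first by exists y.
have [z <-] := alpha_surj y; have [x <-] := IH z.
by exists x.
Qed.

Lemma alpha_pow_center k (x : g) : center g x -> center g (alpha_pow k x).
Proof.
by move=> xC y; have [z <-] := alpha_pow_surj k y; rewrite -alpha_pow_br xC linear0.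
Qed.

Lemma widen_ord_lift n (i : 'I_n) : widen_ord (leqnSn n) i = lift ord_max i.
Proof. exact/val_inj/esym/lift_max. Qed.

(** The arity starts at 2 because the unary bracket, being the identity, does
    not kill central elements; hence the induction starts from [x_1, x_2]. *)
Lemma induced_br_center n (x : {ffun 'I_n.+2 -> g}) i :
  center g (x i) -> induced_br x = 0.
Proof.
elim: n x i => [|n IH] x i; case: (unliftP ord_max i) => [j|] -> xC.
- by rewrite induced_br2 (_ : ord0 = lift ord_max j) //; apply: val_inj; rewrite [j]ord1.
- exact/br_center_r/alpha_pow_center.
- by rewrite induced_brS (IH _ j) ?linear0l // ffunE widen_ord_lift.
- exact/br_center_r/alpha_pow_center.
Qed.

(** The first slot is the one for which the induction on the arity closes:
    dropping the last argument leaves x in first position, free of powers of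
    alpha, down to the unary bracket of x, which is x itself. *)
Lemma induced_br_nondegenerate n (x : g) : center g = [set 0] ->
  (forall y : {ffun 'I_n.+1 -> g}, y ord0 = x -> induced_br y = 0) -> x = 0.
Proof.
move=> C0; elim: n => [|n IH] xP.
  by have := xP [ffun=> x]; rewrite /= ffunE; apply.
apply: IH => y yx.
suff : center g (induced_br y) by rewrite C0.
move=> z; have [w <-] := alpha_pow_surj n z.
(* [[y], alpha^n w] is the longer bracket of y followed by w, so it is zero *)
pose y' := [ffun i : 'I_n.+2 => oapp y w (unlift ord_max i)].
have front_y' : front y' = y.
  by apply/ffunP => i; rewrite !ffunE widen_ord_lift liftK.
have last_y' : y' ord_max = w by rewrite ffunE unlift_none.
have y'x : y' ord0 = x.
  by rewrite -yx -[in RHS]front_y' [RHS]ffunE; congr (y' _); apply: val_inj.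
by rewrite -front_y' -last_y'; apply: xP y'x.
Qed.

End CenterOfInduced.

Theorem lemma3p23 (K : fieldType) (charK : [pchar K] =i pred0)
  (g : homLieSuperalgebra K)
  (alpha_surj : forall y : g, exists x : g, alpha x = y)
  (n : nat) (n_ge2 : (2 <= n)%N) :
  center g = [set 0] <-> ncenter (induced g n) = [set 0].
Proof.
case: n n_ge2 => [|[|n]] // _; split=> C0; apply/seteqP; split=> x /=.
- move=> xC; apply: (induced_br_nondegenerate alpha_surj (n := n.+1) C0) => y yx.
  have := xC ord0 I y; rewrite /= (_ : upd y ord0 x = y) //.
  by apply/ffunP => i; rewrite ffunE; case: eqP => [->|].
- move=> -> i _ y; apply: (induced_br_center alpha_surj (i := i)) => z.
  by rewrite ffunE eqxx linear0l.
- move=> xC; suff : ncenter (induced g n.+2) x by rewrite C0.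
  move=> i _ y; apply: (induced_br_center alpha_surj (i := i)).
  by rewrite ffunE eqxx.
- by move=> -> y; rewrite linear0l.
Qed.
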